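(* Let $X\in\mathbb{R}^{n\times d}$. Ignoring the ordering in the sequences sampled from R-DPP (that is, viewing the sampled sequence as an unordered multiset of indices), the following limits hold pointwise (for the probability of each finite multiset) as $r\to0^+$: $$\text{R-DPP}^{r}\Big(X,\tfrac rn I\Big)\ \longrightarrow\ \mathrm{DPP}(X),$$ whereas, if $\det(X^\top X)\neq0$, $$\text{R-DPP}^{r}(X,0)\ \longrightarrow\ \mathrm{VS}(X).$$
   Context: For a sequence $\sigma\in\{1,\dots,n\}^k$ (or a subset $S$ of $\{1,\dots,n\}$), $X_\sigma$ (resp. $X_S$) is the matrix whose rows are the rows of $X$ indexed by $\sigma$ (resp. $S$); $x_j^\top$ is the $j$-th row of $X$. R-DPP: given $X\in\mathbb{R}^{n\times d}$, a probability distribution $p=(p_1,\dots,p_n)$, a positive semi-definite $A\in\mathbb{R}^{d\times d}$ and $r>0$ (with $\det(A+r\sum_jp_jx_jx_j^\top)\ne0$), $\text{R-DPP}_p^r(X,A)$ is the distribution over all sequences $\tilde\sigma\in\bigcup_{k=0}^\infty\{1,\dots,n\}^k$ given by $$\Pr(\tilde\sigma)=\frac{\det(A+X_{\tilde\sigma}^\top X_{\tilde\sigma})}{\det\big(A+r\,\sum_{j}p_jx_jx_j^\top\big)}\,\frac{r^ke^{-r}}{k!}\prod_{i=1}^kp_{\tilde\sigma_i}\qquad\text{for }\tilde\sigma\in\{1,\dots,n\}^k.$$ When $p$ is uniform, it is denoted $\text{R-DPP}^r(X,A)$. $\mathrm{DPP}(X)$ is the distribution over subsets $S\subseteq\{1,\dots,n\}$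 with $\Pr(S)=\det(X_SX_S^\top)/\det(I+XX^\top)$. Volume sampling $\mathrm{VS}(X)$ (for $\det(X^\top X)\ne0$) is the distribution over subsets $S\subseteq\{1,\dots,n\}$ with $|S|=d$ and $\Pr(S)=\det(X_S)^2/\det(X^\top X)$. Both are regarded as distributions on multisets giving probability $0$ to multisets with repeated elements (and, for VS, to sets of size $\neq d$). *)

(* Defs.v *)
(* MathComp / MathComp-Analysis world. *)
From mathcomp Require Export all_boot all_order all_algebra.
From mathcomp Require Export finmap multiset.
From mathcomp Require Export all_classical all_reals all_analysis.
Export Order.TTheory GRing.Theory Num.Theory.
Export numFieldNormedType.Exports.

Set Implicit Arguments.
Unset Strict Implicit.
Unset Printing Implicit Defensive.

Local Open Scope classical_set_scope.
Local Open Scope ring_scope.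

Section Sampling.
Variables (R : realType) (n d : nat).
Implicit Types (X : 'M[R]_(n, d)) (A : 'M[R]_d) (p : 'I_n -> R) (r : R).
Implicit Types (s : seq 'I_n) (S : {set 'I_n}) (m : {mset 'I_n}%mset).

Definition rows_seq X s : 'M[R]_(size s, d) := rowsub (tnth (in_tuple s)) X.

(* The rows are taken in increasing order of their indices. *)
Definition rows_set X S : 'M[R]_(#|S|, d) := rowsub (fun i => enum_val i) X.

(* The rows of X are the x_j^T, so x_j x_j^T is (row j X)^T *m row j X. *)
Definition second_moment p X : 'M[R]_d :=
  \sum_(j < n) p j *: ((row j X)^T *m row j X).

(* Probability mass function on sequences of arbitrary finite length.  It is
   meaningful when p is a probability vector, A is positive semi-definite,
   0 < r and the denominator is nonzero. *)
Definition rdpp p r X A s : R :=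
  \det (A + (rows_seq X s)^T *m rows_seq X s)
    / \det (A + r *: second_moment p X)
  * (r ^+ size s * expR (- r) / (size s)`!%:R)
  * \prod_(i <- s) p i.

Definition rdpp_unif r X A : seq 'I_n -> R := rdpp (fun=> n%:R^-1) r X A.

(* Pushforward of a mass function along seq_mset; the fibres are finite, so the
   finitely supported sum below is the sum over all orderings of m. *)
Definition unordered (P : seq 'I_n -> R) m : R :=
  \sum_(s \in [set s | seq_mset s = m]) P s.

Definition dpp X S : R :=
  \det (rows_set X S *m (rows_set X S)^T) / \det (1%:M + X *m X^T).

(* When #|S| = d, conform_mx 0 is the cast of X_S to a d x d matrix. *)
Definition vs X S : R :=
  if #|S| == d
  then \det (conform_mx (0 : 'M[R]_d) (rows_set X S)) ^+ 2 / \det (X^T *m X)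
  else 0.

Definition on_multisets (P : {set 'I_n} -> R) m : R :=
  if [forall i, (m i <= 1)%N] then P (finset (fun i => i \in m)) else 0.

End Sampling.

(* Main.v *)
(* Write q = r/n and let M be a k x d matrix whose Gram matrix M^T M is the sum
   of x_i x_i^T over the multiset m of size k.  Summing over the orderings of m
   gives a probability c q^k e^(-r) det(A + M^T M) / det(A + q X^T X), where
   c is the number of orderings divided by k!, hence c = 1 for a set.  For
   A = q I, Sylvester's identity q^k det(q I + M^T M) = q^d det(q I + M M^T)
   cancels every power of q, leaving
   c e^(-r) det(q I + M M^T) / det(I + X X^T), which is continuous at r = 0.
   For A = 0, the power q^(k - d) remains: the limit is 0 for k > d, the rank
   kills the determinant for k < d, and the case k = d is volume sampling.
   A repeated index gives M two equal rows, so both limits vanish. *)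
Require Import Defs.
From mathcomp Require Import ring.

Set Implicit Arguments.
Unset Strict Implicit.
Unset Printing Implicit Defensive.

Local Open Scope classical_set_scope.
Local Open Scope ring_scope.

(** * Determinants of Gram matrices and of their scalar shifts *)

Lemma det_sylvester (R : comNzRingType) k d (A : 'M[R]_(k, d)) (B : 'M[R]_(d, k)) :
  \det (1%:M + A *m B) = \det (1%:M + B *m A).
Proof.
(* Since [U] has determinant 1, [U *m M] and [M *m U] have the same determinant; both are block
   lower triangular, and each shows one side of the identity. *)
pose M := block_mx 1%:M (- A) B (1%:M : 'M[R]_d).
pose U := block_mx (1%:M : 'M[R]_k) A 0 (1%:M : 'M[R]_d).
have detU : \det U = 1 by rewrite det_ublock !det1 mulr1.
have MU : M *m U = block_mx 1%:M 0 B (1%:M + B *m A).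
  by rewrite mulmx_block !mul1mx !mulmx1 !mulmx0 !addr0 subrr addrC.
have UM : U *m M = block_mx (1%:M + A *m B) 0 B 1%:M.
  by rewrite mulmx_block !mul1mx !mulmx1 !mul0mx addNr !add0r.
transitivity (\det (U *m M)); first by rewrite UM det_lblock det1 mulr1.
by rewrite det_mulmx mulrC -det_mulmx MU det_lblock det1 mul1r.
Qed.

Lemma det_sylvester_scalar (F : fieldType) k d (q : F) (A : 'M[F]_(k, d))
    (B : 'M[F]_(d, k)) : q != 0 ->
  q ^+ d * \det (q%:M + A *m B) = q ^+ k * \det (q%:M + B *m A).
Proof.
move=> q0.
have factor j (C : 'M[F]_j) : \det (q%:M + C) = q ^+ j * \det (1%:M + q^-1 *: C).
  by rewrite -detZ scalerDr scale_scalar_mx mulr1 scalerA divff // scale1r.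
by rewrite !factor scalemxAl det_sylvester -scalemxAr mulrCA.
Qed.

Lemma det_gram_eq (R : comNzRingType) k d (M : 'M[R]_(k, d)) : k = d ->
  \det (M^T *m M) = \det (M *m M^T).
Proof. by move=> kd; subst k; rewrite !det_mulmx mulrC. Qed.

Lemma det_gram_conform (R : comNzRingType) k d (M : 'M[R]_(k, d)) : k = d ->
  \det (M^T *m M) = \det (conform_mx (0 : 'M[R]_d) M) ^+ 2.
Proof. by move=> kd; subst k; rewrite conform_mx_id det_mulmx det_tr. Qed.

(** The rank of [M^T *m M] is at most the number [k] of rows of [M], too small for invertibility. *)
Lemma det_gram_lt (F : fieldType) k d (M : 'M[F]_(k, d)) : (k < d)%N ->
  \det (M^T *m M) = 0.
Proof.
move=> ltkd; apply: contraTeq ltkd => det_neq0; rewrite -leqNgt.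
have /mxrank_unit <- : M^T *m M \in unitmx by rewrite unitmxE unitfE.
by rewrite (leq_trans (mxrankM_maxr _ _)) // rank_leq_row.
Qed.

Lemma det_gram_rows0 (R : comNzRingType) k d (M : 'M[R]_(k, d)) i j :
  i != j -> row i M = row j M -> \det (M *m M^T) = 0.
Proof.
move=> neq_ij eq_ij; apply: (determinant_alternate neq_ij) => l.
have /rowP/(_ l) : row i (M *m M^T) = row j (M *m M^T) by rewrite !row_mul eq_ij.
by rewrite ![row _ _ _ _]mxE.
Qed.

Lemma gram_rowsub (R : comNzRingType) n d k (X : 'M[R]_(n, d)) (f : 'I_k -> 'I_n) :
  (rowsub f X)^T *m rowsub f X = \sum_i (row (f i) X)^T *m row (f i) X.
Proof.
apply/matrixP => a b; rewrite mxE summxE; apply: eq_bigr => i _.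
by rewrite !mxE big_ord1 !mxE.
Qed.

Lemma cvg_det_scalar_add (R : realType) k (M : 'M[R]_k) (c : R) :
  \det ((r * c)%:M + M) @[r --> 0^'+] --> \det M.
Proof.
(* A scalar shift evaluates the characteristic polynomial of [- M], so continuity reduces to that of
   a polynomial. *)
have charE x : \det (x%:M + M) = (char_poly (- M)).[x].
  rewrite /char_poly -horner_evalE -det_map_mx; congr (\det _).
  apply/matrixP => i j.
  by rewrite !mxE /= /horner_eval !hornerE hornerMn hornerX opprK.
have -> : (fun r => \det ((r * c)%:M + M)) = (fun r => (char_poly (- M)).[r * c]).
  by apply/funext => r; rewrite charE.
have -> : \det M = (char_poly (- M)).[0 * c] by rewrite -charE mul0r raddf0 add0r.
apply: cvg_at_right_filter.
apply: (cvg_comp ( *%R^~ c) (horner (char_poly (- M)))); last exact: continuous_horner.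
by apply: cvgMl; exact: cvg_id.
Qed.

(** * Summing the R-DPP mass over the orderings of a multiset *)

Section Unordered.
Variables (R : realType) (n d : nat) (X : 'M[R]_(n, d)).
Implicit Types (r : R) (m : {mset 'I_n}%mset) (s : seq 'I_n).

(** A sum over the list, so that invariance under reordering is immediate. *)
Definition gram s : 'M[R]_d := \sum_(i <- s) (row i X)^T *m row i X.

Lemma gram_rows_seq s : (rows_seq X s)^T *m rows_seq X s = gram s.
Proof. by rewrite gram_rowsub [RHS]big_tnth. Qed.

Lemma gram_rows_set (S : {set 'I_n}) :
  (rows_set X S)^T *m rows_set X S = \sum_(i in S) (row i X)^T *m row i X.
Proof. by rewrite gram_rowsub [RHS]big_enum_val. Qed.

Lemma second_moment_unif c : second_moment (fun=> c) X = c *: (X^T *m X).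
Proof.
rewrite /second_moment -scaler_sumr; congr (_ *: _).
by rewrite -(gram_rowsub X id) mxsub_id.
Qed.

(** This is the inverse of the product of the factorials of the multiplicities. *)
Definition ordering_ratio m : R := (size (permutations m))%:R / (size m)`!%:R.

Lemma ordering_ratio_uniq m : uniq m -> ordering_ratio m = 1.
Proof.
by move=> Um; rewrite /ordering_ratio size_permutations // divff // pnatr_eq0 -lt0n fact_gt0.
Qed.

Lemma unordered_permutations (P : seq 'I_n -> R) m :
  unordered P m = \sum_(s <- permutations m) P s.
Proof.
rewrite fsbig_seq ?permutations_uniq //; apply: eq_fsbigl.
apply/seteqP; split=> s /=; rewrite mem_permutations.
  by move=> <-; rewrite perm_sym perm_eq_seq_mset.
by move=> /eq_seq_msetP ->; rewrite seq_mset_id.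
Qed.

Lemma unordered_rdpp_unif r A m :
  unordered (rdpp_unif r X A) m =
  ordering_ratio m * (\det (A + gram m) / \det (A + (r / n%:R) *: (X^T *m X)))
    * ((r / n%:R) ^+ size m * expR (- r)).
Proof.
rewrite unordered_permutations.
(* All orderings of [m] have equal mass, so the sum is their number times the mass of one
   enumeration. *)
rewrite (eq_big_seq (fun=> rdpp_unif r X A m)); last first.
  move=> s; rewrite mem_permutations => sm.
  rewrite /rdpp_unif /rdpp !gram_rows_seq (perm_size sm).
  by rewrite /gram !(perm_big _ sm).
rewrite big_const_seq count_predT iter_addr_0 /rdpp_unif /rdpp gram_rows_seq.
rewrite second_moment_unif scalerA big_const_seq count_predT -Monoid.iteropE.
rewrite -/(_ ^+ _) exprMn /ordering_ratio -mulr_natr.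
by ring.
Qed.

Lemma uniq_msetP m : [forall i, (m i <= 1)%N] = uniq m.
Proof.
have mE i : m i = count_mem i m by rewrite -{1}(seq_mset_id m) mset_seqE.
apply/forallP/idP => [le1|Um i]; last by rewrite mE count_uniq_mem // leq_b1.
apply: count_mem_uniq => i; rewrite -mE.
by have := le1 i; rewrite mE -has_pred1 has_count; case: (count_mem i m) => [|[]].
Qed.

Lemma det_gram_not_uniq s : ~~ uniq s ->
  \det (rows_seq X s *m (rows_seq X s)^T) = 0.
Proof.
case: s => [//|i0 s] /(uniqPn i0) [i [j [ltij ltj eq_ij]]].
have lti := ltn_trans ltij ltj.
apply: (@det_gram_rows0 _ _ _ _ (Ordinal lti) (Ordinal ltj)).
  by rewrite -val_eqE /= ltn_eqF.
by rewrite !row_rowsub !(tnth_nth i0) /= eq_ij.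
Qed.

Lemma gram_set_mset m : uniq m ->
  gram m = (rows_set X [set i in m])^T *m rows_set X [set i in m].
Proof.
move=> Um; rewrite gram_rows_set /gram big_uniq //.
by apply: eq_bigl => i; rewrite inE.
Qed.

Lemma card_set_mset m : uniq m -> #|[set i in m]| = size m.
Proof. by move=> /card_uniqP <-; rewrite cardsE. Qed.

(** * Limits as [r] decreases to 0 *)

Lemma cvg_expRN : expR (- r) @[r --> (0 : R)^'+] --> (1 : R).
Proof.
have -> : (1 : R) = expR (- 0) by rewrite oppr0 expR0.
apply: cvg_at_right_filter.
apply: (cvg_comp -%R expR); last exact: continuous_expR.
by apply: cvgN; exact: cvg_id.
Qed.

Hypothesis n_gt0 : (0 < n)%N.

Lemma intensity_gt0 r : 0 < r -> 0 < r / n%:R.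
Proof. by move=> r_gt0; rewrite divr_gt0 // ltr0n. Qed.

(** The matrix [M] is left free: it becomes [rows_set] when [m] is a set, and [rows_seq] when an
    index repeats. *)
Lemma cvg_unordered_scalar m k (M : 'M[R]_(k, d)) :
  k = size m -> gram m = M^T *m M ->
  unordered (rdpp_unif r X ((r / n%:R)%:M)) m @[r --> 0^'+]
    --> ordering_ratio m * (\det (M *m M^T) / \det (1%:M + X *m X^T)).
Proof.
move=> kE gE.
have cvg_det : ordering_ratio m *
    (\det ((r / n%:R)%:M + M *m M^T) / \det (1%:M + X *m X^T)) * expR (- r)
    @[r --> 0^'+] -->
    ordering_ratio m * (\det (M *m M^T) / \det (1%:M + X *m X^T)) * 1.
  apply: cvgM; last exact: cvg_expRN.
  by apply: cvgMr; apply: cvgMl; exact: cvg_det_scalar_add.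
rewrite mulr1 in cvg_det.
apply: cvg_trans cvg_det; apply: near_eq_cvg; near=> r.
have q_gt0 : 0 < r / n%:R by apply: intensity_gt0; near: r; exact: nbhs_right_gt.
rewrite unordered_rdpp_unif gE; set q := r / n%:R in q_gt0 *.
have q_neq0 : q != 0 by rewrite gt_eqF.
have -> : \det (q%:M + q *: (X^T *m X)) = q ^+ d * \det (1%:M + X *m X^T).
  by rewrite det_sylvester -detZ scalerDr scale_scalar_mx mulr1.
(* Sylvester's identity turns the [k] by [k] determinant of the limit into the [d] by [d] one of the
   mass. *)
have -> : \det (q%:M + M *m M^T) = q ^+ k * \det (q%:M + M^T *m M) / q ^+ d.
  by rewrite -det_sylvester_scalar // mulrAC divff ?mul1r // expf_neq0.
by rewrite -kE invfM; ring.
Unshelve. all: by end_near. Qed.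

Lemma cvg_unordered0 m k (M : 'M[R]_(k, d)) :
  k = size m -> gram m = M^T *m M ->
  unordered (rdpp_unif r X 0) m @[r --> 0^'+]
    --> if k == d then ordering_ratio m * (\det (M^T *m M) / \det (X^T *m X)) else 0.
Proof.
move=> kE gE.
have unordE r : unordered (rdpp_unif r X 0) m =
    ordering_ratio m * (\det (M^T *m M) / \det (X^T *m X))
      * ((r / n%:R) ^+ k / (r / n%:R) ^+ d * expR (- r)).
  by rewrite unordered_rdpp_unif gE !add0r detZ invfM -kE; ring.
(* Truncated subtraction makes the exponent 0 for [k < d]; this is harmless, as the Gram determinant
   is then 0. *)
suff : ordering_ratio m * (\det (M^T *m M) / \det (X^T *m X))
    * ((r / n%:R) ^+ (k - d) * expR (- r)) @[r --> 0^'+]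
    --> if k == d then ordering_ratio m * (\det (M^T *m M) / \det (X^T *m X)) else 0.
  apply: cvg_trans; apply: near_eq_cvg; near=> r.
  have r_gt0 : 0 < r by near: r; exact: nbhs_right_gt.
  rewrite unordE; have [ltkd|ledk] := ltnP k d.
    by rewrite det_gram_lt // mul0r mulr0 !mul0r.
  by rewrite expfB_cond // gt_eqF ?intensity_gt0.
(* The limit is 0 to the power [k - d], which is 1 exactly when the truncated exponent is 0. *)
have cvg_pow : (r / n%:R) ^+ (k - d) @[r --> 0^'+] --> ((k <= d)%N%:R : R).
  have -> : (k <= d)%N%:R = (0 * n%:R^-1) ^+ (k - d) :> R by rewrite mul0r expr0n subn_eq0.
  apply: cvg_at_right_filter.
  apply: (cvg_comp ( *%R^~ n%:R^-1) (fun x : R => x ^+ (k - d))); last exact: exprn_continuous.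
  by apply: cvgMl; exact: cvg_id.
have -> : (if k == d then ordering_ratio m * (\det (M^T *m M) / \det (X^T *m X)) else 0) =
    ordering_ratio m * (\det (M^T *m M) / \det (X^T *m X)) * ((k <= d)%N%:R * 1).
  case: ltngtP => [ltkd|_|_]; rewrite ?mulr1 ?mulr0 //.
  by rewrite det_gram_lt // mul0r mulr0.
by apply: cvgMr; apply: cvgM => //; exact: cvg_expRN.
Unshelve. all: by end_near. Qed.

End Unordered.

Theorem theorem7 (R : realType) (n d : nat) (n_gt0 : (0 < n)%N)
    (X : 'M[R]_(n, d)) :
  (forall m : {mset 'I_n}%mset,
     unordered (rdpp_unif r X ((r / n%:R)%:M)) m @[r --> 0^'+]
       --> on_multisets (dpp X) m) /\
  (\det (X^T *m X) != 0 ->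
   forall m : {mset 'I_n}%mset,
     unordered (rdpp_unif r X 0) m @[r --> 0^'+]
       --> on_multisets (vs X) m).
Proof.
split=> [m|_ m]; rewrite /on_multisets uniq_msetP; case: ifPn => Um.
- have := cvg_unordered_scalar n_gt0 (card_set_mset Um) (gram_set_mset X Um).
  by rewrite ordering_ratio_uniq // mul1r.
- have := cvg_unordered_scalar n_gt0 (erefl (size m)) (esym (gram_rows_seq X m)).
  by rewrite det_gram_not_uniq // mul0r mulr0.
- have := cvg_unordered0 n_gt0 (card_set_mset Um) (gram_set_mset X Um).
  rewrite ordering_ratio_uniq // mul1r /vs; case: eqP => // Sd.
  by rewrite det_gram_conform.
- have := cvg_unordered0 n_gt0 (erefl (size m)) (esym (gram_rows_seq X m)).
  case: eqP => // md.
  (* For a square [M] the two Gram determinants agree, and the repeated row makes that of [M *m M^T]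
     vanish. *)
  by rewrite det_gram_eq // det_gram_not_uniq // mul0r mulr0.
Qed.
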